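(* Let $A, B$ be positive definite matrices and let $C, D$ be positive semidefinite matrices, all of the same size $n \times n$. Then $$\mathrm{Tr}\left[(A-B)(B^{-1}-A^{-1})+(C-D)\left\{(B+D)^{-1}-(A+C)^{-1}\right\}\right] \geq \left| \mathrm{Tr}\left[(C-D)(B+D)^{-1}(A-B)(A+C)^{-1}\right]\right| .$$
   Context: All matrices are complex $n\times n$ matrices; positive definite and positive semidefinite matrices are in particular Hermitian. $\mathrm{Tr}$ denotes the usual (unnormalized) matrix trace. An inequality $\mathrm{Tr}[\cdot] \ge c$ with $c$ real is understood to mean that the trace is a real number and is at least $c$. *)

(* Defs.v *)
From mathcomp Require Import all_boot all_order all_algebra.
From mathcomp Require Import reals complex.

Set Implicit Arguments.
Unset Strict Implicit.
Unset Printing Implicit Defensive.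

Import GRing.Theory Num.Theory.
Local Open Scope ring_scope.
Local Open Scope sesquilinear_scope.

(* On a numClosedFieldType, [0 < z] and [0 <= z] entail that z is real. *)

Definition posdefmx (C : numClosedFieldType) (n : nat) (A : 'M[C]_n) : Prop :=
  A \is hermsymmx /\
  forall x : 'cV[C]_n, x != 0 -> 0 < (x ^t* *m A *m x) 0 0.

Definition possemidefmx (C : numClosedFieldType) (n : nat) (A : 'M[C]_n) :
    Prop :=
  A \is hermsymmx /\
  forall x : 'cV[C]_n, 0 <= (x ^t* *m A *m x) 0 0.

(* Main.v *)
Require Import Defs.
From mathcomp Require Import all_boot all_order all_algebra.
From mathcomp Require Import reals complex.

Local Open Scope ring_scope.

(** Put X = A - B, Y = C - D, P = A + C and Q = B + D, so that X + Y = P - Q.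
    The identity B^-1 - A^-1 = B^-1 (A - B) A^-1 ([invmxB]), applied also to
    Q and P, turns the trace on the right into
      T = a' + b + c,   a' = tr (X B^-1 X A^-1),
      b = tr (Y Q^-1 Y P^-1),   c = tr (Y Q^-1 X P^-1),
    and c is exactly the trace on the left. The sesquilinear form
    (U, V) |-> tr (U^* Q^-1 V P^-1) is positive, because it is the trace of a
    product of two positive semidefinite matrices ([psd_trace_mul_ge0]); on
    Hermitian matrices it is U, V |-> tr (U Q^-1 V P^-1).

    The number T is real, being a sum of traces of products of two Hermitian
    matrices, and a' + b >= 0 is real, so c = T - (a' + b) is real. It remains
    to see that T - c >= 0 and T + c >= 0. The first is a' + b >= 0. For the
    second, let a = tr (X Q^-1 X P^-1). Inversion is antitone on positive
    definite matrices ([psd_invmxB]), and B <= Q, A <= P, so a' >= a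
    ([trace_form_mono]); hence
      T + c >= a + b + 2 c = tr ((X + Y) Q^-1 (X + Y) P^-1) >= 0,
    where the two cross terms agree since they are conjugate to each other and
    c is real. *)

Import Order.TTheory GRing.Theory Num.Theory.
Local Open Scope sesquilinear_scope.

(** * Adjoints and Hermitian matrices *)

Lemma adjmxM {F : numClosedFieldType} {m n p : nat}
    (A : 'M[F]_(m, n)) (B : 'M[F]_(n, p)) :
  (A *m B)^t* = B^t* *m A^t*.
Proof. by rewrite trmx_mul map_mxM. Qed.

Lemma hermsymmxP {F : numClosedFieldType} {n : nat} (A : 'M[F]_n) :
  reflect (A^t* = A) (A \is hermsymmx).
Proof.
by apply: (iffP (is_hermitianmxP _ _ _)); rewrite expr0 scale1r => /esym.
Qed.

Lemma hermsymmxD {F : numClosedFieldType} {n : nat} (A B : 'M[F]_n) :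
  A \is hermsymmx -> B \is hermsymmx -> A + B \is hermsymmx.
Proof.
move=> /hermsymmxP hA /hermsymmxP hB; apply/hermsymmxP.
by rewrite linearD map_mxD hA hB.
Qed.

Lemma hermsymmxB {F : numClosedFieldType} {n : nat} (A B : 'M[F]_n) :
  A \is hermsymmx -> B \is hermsymmx -> A - B \is hermsymmx.
Proof.
move=> /hermsymmxP hA /hermsymmxP hB; apply/hermsymmxP.
by rewrite linearB map_mxB hA hB.
Qed.

Lemma hermsymmxV {F : numClosedFieldType} {n : nat} (A : 'M[F]_n) :
  A \is hermsymmx -> invmx A \is hermsymmx.
Proof.
by move=> /hermsymmxP hA; apply/hermsymmxP; rewrite trmx_inv map_invmx hA.
Qed.

Lemma mxtrace_adj {F : numClosedFieldType} {n : nat} (A : 'M[F]_n) :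
  \tr (A^t*) = (\tr A)^*.
Proof. by rewrite -map_trmx mxtrace_tr trace_map_mx. Qed.

(** The conjugate of tr (A B) is tr (B A), which equals tr (A B). *)
Lemma herm_trace_mul_real {F : numClosedFieldType} {n : nat} (A B : 'M[F]_n) :
  A \is hermsymmx -> B \is hermsymmx -> \tr (A *m B) \is Num.real.
Proof.
move=> /hermsymmxP hA /hermsymmxP hB; apply/CrealP.
by rewrite -mxtrace_adj adjmxM hA hB mxtrace_mulC.
Qed.

(** Conjugating tr (A B C D) reverses the four factors; cyclicity then swaps
    the first factor with the third. *)
Lemma herm_trace_mul4_conj {F : numClosedFieldType} {n : nat}
    (A B C D : 'M[F]_n) :
  A \is hermsymmx -> B \is hermsymmx -> C \is hermsymmx -> D \is hermsymmx ->
  (\tr (A *m B *m C *m D))^* = \tr (C *m B *m A *m D).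
Proof.
move=> /hermsymmxP hA /hermsymmxP hB /hermsymmxP hC /hermsymmxP hD.
by rewrite -mxtrace_adj !adjmxM hA hB hC hD mxtrace_mulC !mulmxA.
Qed.

(** * Positive semidefinite matrices *)

Lemma posdefmx_psd {F : numClosedFieldType} {n : nat} (A : 'M[F]_n) :
  posdefmx A -> possemidefmx A.
Proof.
move=> [hA pA]; split=> // x; have [->|/pA/ltW //] := eqVneq x 0.
by rewrite mulmx0 mxE.
Qed.

(** A kernel vector of A would be a zero of its quadratic form. *)
Lemma posdefmx_unit {F : numClosedFieldType} {n : nat} (A : 'M[F]_n) :
  posdefmx A -> A \in unitmx.
Proof.
move=> [_ pA]; rewrite -unitmx_tr -row_free_unit -kermx_eq0.
apply/eqP/row_matrixP => i; rewrite row0; apply: contraTeq isT => /= k_neq0.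
have /pA : (row i (kermx A^T))^T != 0 by rewrite -trmx0 (inj_eq trmx_inj).
have Ak0 : A *m (row i (kermx A^T))^T = 0.
  by rewrite -{1}[A]trmxK -trmx_mul -row_mul mulmx_ker row0 trmx0.
by rewrite -mulmxA Ak0 mulmx0 mxE ltxx.
Qed.

Lemma psdD {F : numClosedFieldType} {n : nat} (A B : 'M[F]_n) :
  possemidefmx A -> possemidefmx B -> possemidefmx (A + B).
Proof.
move=> [hA pA] [hB pB]; split=> [|x]; first exact: hermsymmxD.
by rewrite mulmxDr mulmxDl mxE addr_ge0.
Qed.

Lemma posdefmxD_psd {F : numClosedFieldType} {n : nat} (A B : 'M[F]_n) :
  posdefmx A -> possemidefmx B -> posdefmx (A + B).
Proof.
move=> [hA pA] [hB pB]; split=> [|x x_neq0]; first exact: hermsymmxD.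
by rewrite mulmxDr mulmxDl mxE ltr_wpDr ?pA.
Qed.

Lemma psd_congr {F : numClosedFieldType} {m n : nat}
    (S : 'M[F]_(m, n)) (A : 'M[F]_n) :
  possemidefmx A -> possemidefmx (S *m A *m S^t*).
Proof.
move=> [/hermsymmxP hA pA]; split=> [|x].
  by apply/hermsymmxP; rewrite !adjmxM trmxCK hA mulmxA.
by have := pA (S^t* *m x); rewrite adjmxM trmxCK !mulmxA.
Qed.

Lemma psd_congr_herm {F : numClosedFieldType} {n : nat} (S A : 'M[F]_n) :
  S \is hermsymmx -> possemidefmx A -> possemidefmx (S *m A *m S).
Proof. by move=> /hermsymmxP {2}<-; apply: psd_congr. Qed.

Lemma psd_diag_ge0 {F : numClosedFieldType} {n : nat} (A : 'M[F]_n) i :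
  possemidefmx A -> 0 <= A i i.
Proof.
move=> [_ /(_ (delta_mx i 0))]; rewrite trmx_delta map_delta_mx -rowE -colE.
by rewrite !mxE.
Qed.

(** Diagonalise B as U^* diag(d) U with U unitary. Then tr (A B) is the sum of
    the (U A U^* )_ii d_i, and both U A U^* and diag(d) = U B U^* are
    congruent to positive semidefinite matrices. *)
Lemma psd_trace_mul_ge0 {F : numClosedFieldType} {n : nat} (A B : 'M[F]_n) :
  possemidefmx A -> possemidefmx B -> 0 <= \tr (A *m B).
Proof.
move=> psdA psdB.
have /orthomx_spectralP := hermitian_normalmx psdB.1.
set U := spectralmx B; set d := spectral_diag B => defB.
have Uunit : U \is unitarymx := spectral_unitarymx B.
have d_ge0 i : 0 <= d 0 i.
  have := psd_diag_ge0 _ i (psd_congr U _ psdB).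
  rewrite {1}defB invmx_unitary // !mulmxA mulmxtVK // (unitarymxP Uunit).
  by rewrite mul1mx mxE eqxx mulr1n.
rewrite {1}defB invmx_unitary // !mulmxA mxtrace_mulC !mulmxA mul_mx_diag.
apply: sumr_ge0 => i _; rewrite mxE mulr_ge0 //.
exact/psd_diag_ge0/psd_congr.
Qed.

(** * Inverses and the trace form *)

Lemma invmxB {F : fieldType} {n : nat} (A B : 'M[F]_n) :
  A \in unitmx -> B \in unitmx ->
  invmx A - invmx B = invmx A *m (B - A) *m invmx B.
Proof.
by move=> uA uB; rewrite mulmxBr mulmxBl mulmxK // mulVmx // mul1mx.
Qed.

Lemma psdV {F : numClosedFieldType} {n : nat} (A : 'M[F]_n) :
  posdefmx A -> possemidefmx (invmx A).
Proof.
move=> pA; have := psd_congr_herm _ _ (hermsymmxV _ pA.1) (posdefmx_psd _ pA).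
by rewrite mulVmx ?mul1mx ?posdefmx_unit.
Qed.

(** Antitonicity of inversion. With Q = A + D the difference is Q^-1 D A^-1;
    to exhibit a congruence, write D A^-1 = (D + D A^-1 D) Q^-1. *)
Lemma psd_invmxB {F : numClosedFieldType} {n : nat} (A D : 'M[F]_n) :
  posdefmx A -> possemidefmx D ->
  possemidefmx (invmx A - invmx (A + D)).
Proof.
move=> pA pD; have pQ := posdefmxD_psd _ _ pA pD.
have uA := posdefmx_unit _ pA; have uQ := posdefmx_unit _ pQ.
have -> : invmx A - invmx (A + D) =
    invmx (A + D) *m (D + D *m invmx A *m D) *m invmx (A + D).
  have -> : D + D *m invmx A *m D = D *m invmx A *m (A + D).
    by rewrite mulmxDr mulmxKV.
  by rewrite !mulmxA mulmxK // -opprB invmxB // opprD addNKr mulmxN mulNmx opprK.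
apply: psd_congr_herm (hermsymmxV _ pQ.1) _; apply: psdD => //.
exact: psd_congr_herm pD.1 (psdV _ pA).
Qed.

Lemma trace_formD {R : comNzRingType} {n : nat} (X Y M N : 'M[R]_n) :
  \tr ((X + Y) *m M *m (X + Y) *m N) =
  \tr (X *m M *m X *m N) + \tr (Y *m M *m Y *m N)
  + (\tr (X *m M *m Y *m N) + \tr (Y *m M *m X *m N)).
Proof.
rewrite mulmxDr !mulmxDl !linearD /= -!addrA; congr (_ + _).
by rewrite addrCA [RHS]addrC -!addrA; congr (_ + _); rewrite addrC -addrA.
Qed.

Lemma trace_form_ge0 {F : numClosedFieldType} {n : nat} (X M N : 'M[F]_n) :
  X \is hermsymmx -> possemidefmx M -> possemidefmx N ->
  0 <= \tr (X *m M *m X *m N).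
Proof. by move=> hX pM pN; apply/psd_trace_mul_ge0/pN/psd_congr_herm. Qed.

(** Lower the two weights one after the other. *)
Lemma trace_form_mono {F : numClosedFieldType} {n : nat}
    (X M M' N N' : 'M[F]_n) :
  X \is hermsymmx -> possemidefmx M' -> possemidefmx N ->
  possemidefmx (M - M') -> possemidefmx (N - N') ->
  \tr (X *m M' *m X *m N') <= \tr (X *m M *m X *m N).
Proof.
move=> hX pM' pN pM pN'; apply: (@le_trans _ _ (\tr (X *m M' *m X *m N))).
  by rewrite -subr_ge0 -linearB -mulmxBr; apply: trace_form_ge0.
rewrite -subr_ge0 -linearB -mulmxBl -mulmxBl -mulmxBr.
exact: trace_form_ge0.
Qed.

Lemma norm_trace_le {F : numClosedFieldType} {n : nat} (A B C D : 'M[F]_n) :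
  posdefmx A -> posdefmx B -> possemidefmx C -> possemidefmx D ->
  `|\tr ((C - D) *m invmx (B + D) *m (A - B) *m invmx (A + C))| <=
  \tr ((A - B) *m (invmx B - invmx A)
       + (C - D) *m (invmx (B + D) - invmx (A + C))).
Proof.
move=> pA pB pC pD.
have pP := posdefmxD_psd _ _ pA pC; have pQ := posdefmxD_psd _ _ pB pD.
have hX := hermsymmxB _ _ pA.1 pB.1; have hY := hermsymmxB _ _ pC.1 pD.1.
have iP := psdV _ pP; have iQ := psdV _ pQ.
have iA := psdV _ pA; have iB := psdV _ pB.
set T := \tr (_ + _); set c := \tr _.
have T_real : T \is Num.real.
  rewrite /T linearD realD // herm_trace_mul_real //.
    exact: hermsymmxB iB.1 iA.1.
  exact: hermsymmxB iQ.1 iP.1.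
pose a' := \tr ((A - B) *m invmx B *m (A - B) *m invmx A).
pose b := \tr ((C - D) *m invmx (B + D) *m (C - D) *m invmx (A + C)).
have defT : T = a' + b + c.
  rewrite /T !invmxB ?posdefmx_unit // opprD addrACA linearD !mulmxA.
  rewrite -[RHS]addrA; congr (_ + _).
  by rewrite (mulmxDr _ (A - B)) (mulmxDl _ (_ *m (C - D))) linearD addrC.
have a'_ge0 : 0 <= a' by apply: trace_form_ge0.
have b_ge0 : 0 <= b by apply: trace_form_ge0.
have c_real : c \is Num.real.
  have -> : c = T - (a' + b) by rewrite defT addrC addKr.
  by rewrite realB // ger0_real // addr_ge0.
have c_swap :
    \tr ((A - B) *m invmx (B + D) *m (C - D) *m invmx (A + C)) = c.
  rewrite -[RHS](CrealP c_real) herm_trace_mul4_conj //.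
    exact: iQ.1.
  exact: iP.1.
pose a := \tr ((A - B) *m invmx (B + D) *m (A - B) *m invmx (A + C)).
have le_aa' : a <= a' by apply: trace_form_mono => //; apply: psd_invmxB.
have square_ge0 : 0 <= a + b + (c + c).
  have := trace_form_ge0 _ _ _ (hermsymmxD _ _ hX hY) iQ iP.
  by rewrite trace_formD c_swap.
rewrite real_ler_norml // defT; apply/andP; split; last first.
  by rewrite lerDr addr_ge0.
rewrite lerNl -subr_ge0 opprK -addrA; apply: le_trans square_ge0 _.
by rewrite !lerD2r.
Qed.

(* The order on R[i] is the partial one: [x <= y] means that y - x is a
   nonnegative real.  Hence the inequality asserts in particular that the
   trace on the right is real. *)
Theorem theorem2p1 (R : realType) (n : nat) (A B C D : 'M[R[i]]_n)
    (hA : posdefmx A) (hB : posdefmx B)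
    (hC : possemidefmx C) (hD : possemidefmx D) :
  `|\tr ((C - D) *m invmx (B + D) *m (A - B) *m invmx (A + C))| <=
  \tr ((A - B) *m (invmx B - invmx A)
       + (C - D) *m (invmx (B + D) - invmx (A + C))).
Proof. exact: norm_trace_le. Qed.
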